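(* Let $\mathcal{H}$ be a separable complex Hilbert space and let $A$ be a closed densely defined operator on $\mathcal{H}$ with non-empty resolvent set $\rho(A)$. Let $z\in\rho(A)$. Let $\{\psi_n\}_{n\in\mathbf{N}}$ be a sequence in $\mathcal{H}$ with $\|\psi_n\|=1$ for all $n$ and $\lim_{n\to\infty}\|R_A(z)\psi_n\|=\|R_A(z)\|$, such that the following three limits exist: $$\alpha=\lim_{n\to\infty}\langle R_A(z)\psi_n,R_A(z)^2\psi_n\rangle,\quad \beta=\lim_{n\to\infty}\|R_A(z)^2\psi_n\|^2,\quad \gamma=\lim_{n\to\infty}\langle R_A(z)\psi_n,R_A(z)^3\psi_n\rangle.$$ Then the following hold. (i) Assume $\alpha\neq0$. For any $\theta\in(-\tfrac{\pi}{2},\tfrac{\pi}{2})$ there exist $C>0$ and $\varepsilon_0>0$ such that for every $z'\neq z$ with $|z'-z|\leq\varepsilon_0$ and $\arg(z'-z)=\theta-\arg\alpha$ we have $[z,z']\subset\rho(A)$ and $$\|R_A(\zeta)\|\geq\|R_A(z)\|+C|\zeta-z|,\quad \zeta\in[z,z'].$$ (ii) Assume $\alpha=0$ and $\gamma\neq0$. For any $\theta\in(-\tfrac{\pi}{4},\tfrac{\pi}{4})\cup(\tfrac{3\pi}{4},\tfrac{5\pi}{4})$ there exist $C>0$ and $\varepsilon_0>0$ such that for every $z'\neq z$ with $|z'-z|\leq\varepsilon_0$ and $\arg(z'-z)=\theta-\tfrac12\arg\gamma$ we have $[z,z']\subset\rho(A)$ and $$\|R_A(\zeta)\|\geq\|R_A(z)\|+C|\zeta-z|^2,\quad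 \zeta\in[z,z'].$$ (iii) Assume $\alpha=0$, $\gamma=0$, and $\beta>0$. Then there exist $C>0$ and $\varepsilon_0>0$ such that for all $\zeta\in\rho(A)$ with $|\zeta-z|\leq\varepsilon_0$ we have $$\|R_A(\zeta)\|\geq\|R_A(z)\|+C|\zeta-z|^2.$$ (iv) Assume $\beta=0$. Then $$\|R_A(\zeta)\|\geq\|R_A(z)\|\quad\text{for all }\zeta\in\rho(A).$$
   Context: For $z\in\rho(A)$ the resolvent is the bounded operator $R_A(z)=(A-zI)^{-1}$ on $\mathcal{H}$, and $\|R_A(z)\|$ is its operator norm. The inner product $\langle\cdot,\cdot\rangle$ is conjugate-linear in the first argument and linear in the second. For $z,z'\in\mathbf{C}$, $[z,z']$ denotes the straight line segment from $z$ to $z'$. Equalities between arguments of non-zero complex numbers are understood modulo $2\pi$; $\arg$ of a non-zero complex number denotes any fixed choice of its argument. *)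

(* Defs.v *)
From Stdlib Require Import Reals.
From Coquelicot Require Import Coquelicot.

Open Scope R_scope.

(* [CompleteNormedModule] provides the uniform structure, which its axioms make
   equivalent to the one defined by [norm]; [inner_norm] says that [norm] is the
   norm induced by the inner product and contains positive definiteness.
   The product is linear in the second argument, hence conjugate-linear in the
   first. *)
Record HilbertSpace := {
  hilbert_carrier :> CompleteNormedModule C_AbsRing;
  inner : hilbert_carrier -> hilbert_carrier -> C;
  inner_conj : forall x y, inner y x = Cconj (inner x y);
  inner_plus : forall x y1 y2,
    inner x (plus y1 y2) = (inner x y1 + inner x y2)%C;
  inner_scal : forall x (k : C) y, inner x (scal k y) = (k * inner x y)%C;
  inner_norm : forall x, inner x x = RtoC (norm x ^ 2)
}.

Arguments inner {h} _ _.

Definition dense {T : UniformSpace} (D : T -> Prop) : Prop :=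
  forall (x : T) (eps : posreal), exists y, D y /\ ball x eps y.

Definition separable (T : UniformSpace) : Prop :=
  exists u : nat -> T, dense (fun x => exists n, x = u n).

(* The map [op_fun] is total only for convenience: its values outside the domain
   [op_dom] are arbitrary and never used below. *)
Record operator (H : HilbertSpace) := {
  op_dom : H -> Prop;
  op_fun :> H -> H;
  op_dom_zero : op_dom zero;
  op_dom_plus : forall x y, op_dom x -> op_dom y -> op_dom (plus x y);
  op_dom_scal : forall (k : C) x, op_dom x -> op_dom (scal k x);
  op_fun_plus : forall x y, op_dom x -> op_dom y ->
    op_fun (plus x y) = plus (op_fun x) (op_fun y);
  op_fun_scal : forall (k : C) x, op_dom x ->
    op_fun (scal k x) = scal k (op_fun x)
}.

Arguments op_dom {H} _ _.
Arguments op_fun {H} _ _.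

Section Operators.

Context {H : HilbertSpace}.

Implicit Types (A : operator H) (z : C).

Definition densely_defined A : Prop := dense (op_dom A).

Definition closed_operator A : Prop :=
  closed (fun p : H * H => op_dom A (fst p) /\ snd p = A (fst p)).

Definition solves A z (x y : H) : Prop :=
  op_dom A y /\ minus (A y) (scal z y) = x.

(* [iota P] is the unique element satisfying [P] if there is exactly one. *)
Definition resolvent A z (x : H) : H := iota (solves A z x).

(* [is_linear] includes boundedness. *)
Definition resolvent_set A z : Prop :=
  (forall x, exists! y, solves A z x y) /\ is_linear (resolvent A z).

(* Finite, hence the usual operator norm, whenever [T] is bounded; [real] would
   send an infinite supremum to 0. *)
Definition opnorm (T : H -> H) : R :=
  real (Lub_Rbar (fun r => exists x : H, norm x <= 1 /\ r = norm (T x))).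

End Operators.

(* [t] is one of the values, modulo 2 PI, of the argument of [w]. *)
Definition is_arg (w : C) (t : R) : Prop :=
  w <> RtoC 0 /\ w = (RtoC (Cmod w) * (cos t, sin t))%C.

Definition segment (z z' zeta : C) : Prop :=
  exists t : R, 0 <= t <= 1 /\ zeta = (z + RtoC t * (z' - z))%C.

(* Main.v *)
Require Import Defs.
From Stdlib Require Import Reals.
From Coquelicot Require Import Coquelicot.
From Stdlib Require Import Lra Lia.

Open Scope R_scope.

(** Write [R] for [resolvent A z], [R(zeta)] for [resolvent A zeta], [r] for
    [opnorm R] and [w = zeta - z]. For [Cmod w * r <= 1/2] the Neumann series
    shows that [zeta] is in the resolvent set ([resolvent_set_ball]), and the
    resolvent identity gives
    [R(zeta) x = R x + w R^2 x + w^2 R^3 x + w^3 R^3 R(zeta) x]. Expanding the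
    squared norm of the right-hand side,

    [norm (R(zeta) x)^2 >= norm (R x)^2 + 2 Re (w <R x, R^2 x>)
       + Cmod w^2 norm (R^2 x)^2 + 2 Re (w^2 <R x, R^3 x>) - 8 r^5 Cmod w^3]

    for every unit vector [x] ([resolvent_norm_sq_ge]). Along [x = psi n] the
    left-hand side stays below [opnorm R(zeta) ^ 2] and the right-hand side
    converges, so that

    [opnorm R(zeta) ^ 2 >= r^2 + 2 Re (w alpha) + Cmod w^2 beta
       + 2 Re (w^2 gamma) - 8 r^5 Cmod w^3]

    ([opnorm_sq_ge]). The sum of the three terms between [r^2] and the
    remainder is the [increment]. Whenever it grows like [Cmod w ^ k] with [k]
    equal to 1 or 2, it dominates the remainder for small [w] and the growth
    passes from the square of the norm to the norm ([growth]).

    In (i) the increment is at least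
    [2 Cmod w (Cmod alpha) (cos theta) - O(Cmod w^2)], because [theta] is the
    argument of [w alpha]; in (ii) it is at least
    [2 Cmod w^2 (Cmod gamma) (cos (2 theta))], because [2 theta] is the argument
    of [w^2 gamma], and the two ranges of [theta] are those where this cosine is
    positive; in (iii) it is [beta Cmod w^2]. The term [Cmod w^2 beta], being
    nonnegative, can be dropped in the first two cases.

    Statement (iv) is global, hence out of reach of the expansion. There
    [R (R (psi n))] tends to [0], and two uses of the resolvent identity show
    that [R(zeta) (psi n) - R (psi n)] tends to [0] ([opnorm_ge_of_beta_0]). *)

(** * The geometry of the Hilbert space *)

Lemma minus_plus_plus {G : AbelianGroup} (v x y : G) :
  minus (plus v x) (plus v y) = minus x y.
Proof.
unfold minus. rewrite opp_plus, (plus_comm v x), <- plus_assoc, (plus_assoc v).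
rewrite plus_opp_r, plus_zero_l. reflexivity.
Qed.

Lemma minus_plus_r {G : AbelianGroup} (x y : G) : minus x (plus x y) = opp y.
Proof.
unfold minus. rewrite opp_plus, (plus_assoc x), plus_opp_r. apply plus_zero_l.
Qed.

Section InnerProduct.

Context {H : HilbertSpace}.
Implicit Types x y : H.

(** This lemma and the next ones, up to [norm_zero_le_1], restate general facts
    with the canonical structures that elaboration finds for [H]; those in the
    general statements are convertible to them but not syntactically equal,
    which defeats [rewrite] and [lra]. *)
Lemma norm_plus_le x y : norm (plus x y) <= norm x + norm y.
Proof. exact (norm_triangle x y). Qed.

Lemma scal_plus (k : C) x y :
  scal k (plus x y) = plus (scal k x) (scal k y).
Proof. exact (scal_distr_l k x y). Qed.

Lemma scal_scal (k l : C) x : scal k (scal l x) = scal (k * l)%C x.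
Proof. exact (scal_assoc k l x). Qed.

Lemma plus_A x y v : plus x (plus y v) = plus (plus x y) v.
Proof. exact (plus_assoc x y v). Qed.

Lemma plus_medial a b x y :
  plus (plus a b) (plus x y) = plus (plus a x) (plus b y) :> H.
Proof.
rewrite <- !plus_A, (plus_A b).
rewrite (plus_comm b x : plus b x = plus x b), <- plus_A. reflexivity.
Qed.

Lemma norm_minus_plus x y : norm (minus x (plus x y)) = norm y.
Proof.
transitivity (norm (opp y)); [f_equal; exact (minus_plus_r x y)|].
exact (norm_opp y).
Qed.

Lemma norm_zero_le_1 : norm (zero : H) <= 1.
Proof. rewrite (norm_zero (V := H) : norm (zero : H) = 0); lra. Qed.

Lemma inner_plus_l x y v :
  inner (plus x y) v = (inner x v + inner y v)%C.
Proof.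
rewrite inner_conj, inner_plus, (inner_conj _ x v), (inner_conj _ y v).
apply injective_projections; simpl; ring.
Qed.

Lemma inner_scal_l x (k : C) y : inner (scal k x) y = (Cconj k * inner x y)%C.
Proof.
rewrite inner_conj, inner_scal, (inner_conj _ x y).
apply injective_projections; simpl; ring.
Qed.

Lemma norm_plus_sq x y :
  norm (plus x y) ^ 2 = norm x ^ 2 + 2 * Re (inner x y) + norm y ^ 2.
Proof.
assert (E : inner (plus x y) (plus x y) = RtoC (norm (plus x y) ^ 2))
  by apply inner_norm.
rewrite inner_plus_l, !inner_plus, !inner_norm, (inner_conj _ x y) in E.
apply (f_equal Re) in E; unfold Re in *; simpl in *; lra.
Qed.

(** The inner product turns the inequality [norm_scal] into an equality. *)
Lemma norm_scal_C (k : C) x : norm (scal k x) = Cmod k * norm x.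
Proof.
assert (E : inner (scal k x) (scal k x) = RtoC (norm (scal k x) ^ 2))
  by apply inner_norm.
rewrite inner_scal_l, inner_scal, inner_norm in E.
apply (f_equal Re) in E.
assert (S : norm (scal k x) ^ 2 = (Cmod k * norm x) ^ 2).
{ rewrite Rpow_mult_distr, Cmod2_alt. unfold Re, Im in *. simpl in E |- *. lra. }
rewrite <- !Rsqr_pow2 in S.
apply Rsqr_inj in S; auto using norm_ge_0, Rmult_le_pos, Cmod_ge_0.
Qed.

(** The real part of the Cauchy-Schwarz inequality is the triangle inequality
    for [norm], read through the expansion of [norm (x - y) ^ 2]. *)
Lemma re_inner_ge x y : - (norm x * norm y) <= Re (inner x y).
Proof.
assert (E := norm_plus_sq x (scal (RtoC (-1)) y)).
rewrite norm_scal_C, inner_scal, Cmod_R, Rabs_left in E by lra.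
assert (T := norm_plus_le x (scal (RtoC (-1)) y)).
rewrite norm_scal_C, Cmod_R, Rabs_left in T by lra.
assert (P := norm_ge_0 (plus x (scal (RtoC (-1)) y))).
assert (Q : norm (plus x (scal (RtoC (-1)) y)) ^ 2 <= (norm x + norm y) ^ 2).
{ apply pow_incr; lra. }
unfold Re in *; simpl in E, Q |- *. lra.
Qed.

(** The vectors are the terms of the expansion [a + w b + w^2 c + w^3 e] of
    the resolvent. With [u = a + w b] and [v = w^2 (c + w e)], the bound comes
    from [norm u ^ 2 + 2 Re <u, v> <= norm (u + v) ^ 2]: of [2 Re <u, v>] the
    term of order two is kept and the others are bounded by
    Cauchy-Schwarz. *)
Lemma norm_expansion_ge (a b c e : H) (w : C) :
  norm a ^ 2 + 2 * Re (w * inner a b) + Cmod w ^ 2 * norm b ^ 2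
    + 2 * Re (w * w * inner a c)
    - 2 * Cmod w ^ 3
      * (norm a * norm e + norm b * norm (plus c (scal w e)))
  <= norm (plus (plus a (scal w b)) (scal (w * w)%C (plus c (scal w e)))) ^ 2.
Proof.
set (c' := plus c (scal w e)).
rewrite (norm_plus_sq (plus a (scal w b))), (norm_plus_sq a), !norm_scal_C.
rewrite inner_plus_l.
assert (E1 : inner a (scal (w * w)%C c') =
  (w * w * inner a c + inner a (scal (w * w * w)%C e))%C).
{ unfold c'. rewrite !inner_scal, inner_plus, inner_scal. ring. }
rewrite E1, inner_scal.
assert (B1 := re_inner_ge a (scal (w * w * w)%C e)).
assert (B2 := re_inner_ge (scal w b) (scal (w * w)%C c')).
rewrite norm_scal_C, !Cmod_mult in B1.
rewrite !norm_scal_C, !Cmod_mult in B2.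
assert (P : 0 <= (Cmod (w * w)%C * norm c') ^ 2) by apply pow2_ge_0.
rewrite (re_plus (w * w * inner a c + _)%C), (re_plus (w * w * inner a c)%C).
rewrite (Rpow_mult_distr (Cmod w) (norm b)).
simpl pow in *. lra.
Qed.

End InnerProduct.

(** * Operator norms and resolvents *)

Section Resolvents.

Context {H : HilbertSpace}.
Implicit Types (T : H -> H) (A : operator H).

(** [linear_plus] and [linear_scal], restated for the same reason as
    [norm_plus_le]. *)
Lemma linear_op_plus T : is_linear T ->
  forall x y : H, T (plus x y) = plus (T x) (T y).
Proof. intros L x y; exact (linear_plus T L x y). Qed.

Lemma linear_op_scal T : is_linear T ->
  forall (k : C) (x : H), T (scal k x) = scal k (T x).
Proof. intros L k x; exact (linear_scal T L k x). Qed.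

Lemma opnorm_is_lub T : is_linear T ->
  is_lub (fun r => exists x : H, norm x <= 1 /\ r = norm (T x)) (opnorm T).
Proof.
intros L; destruct (linear_norm T L) as [M [M0 HM]].
unfold opnorm; set (E := fun r => _).
assert (Lub := Lub_Rbar_correct E).
assert (E0 : exists r, E r).
{ exists (norm (T zero)), zero; auto using norm_zero_le_1. }
destruct E0 as [r0 E0].
destruct (Lub_Rbar E) as [l | | ].
- split.
  + intros r Er; exact (proj1 Lub r Er).
  + intros b Hb; exact (proj2 Lub (Finite b) Hb).
- exfalso; refine (proj2 Lub (Finite M) _).
  intros r [x [x1 ->]]; simpl.
  apply Rle_trans with (1 := HM x).
  rewrite <- (Rmult_1_r M) at 2. apply Rmult_le_compat_l; lra.
- destruct (proj1 Lub r0 E0).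
Qed.

Lemma opnorm_ge_0 T : is_linear T -> 0 <= opnorm T.
Proof.
intros L; apply Rle_trans with (norm (T zero)); [apply norm_ge_0|].
apply (opnorm_is_lub T L); exists zero; auto using norm_zero_le_1.
Qed.

Lemma norm_le_opnorm T x : is_linear T -> norm (T x) <= opnorm T * norm x.
Proof.
intros L.
destruct (Rle_lt_or_eq_dec 0 (norm x) (norm_ge_0 x)) as [x0 | x0].
- set (k := RtoC (/ norm x)).
  assert (i0 := Rinv_0_lt_compat _ x0).
  assert (Hk : Cmod k = / norm x).
  { unfold k; rewrite Cmod_R, Rabs_pos_eq; lra. }
  assert (B : norm (T (scal k x)) <= opnorm T).
  { apply (opnorm_is_lub T L); exists (scal k x); split; auto.
    rewrite norm_scal_C, Hk, Rinv_l; lra. }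
  rewrite (linear_op_scal T L), norm_scal_C, Hk in B.
  apply Rmult_le_reg_l with (/ norm x); [assumption|].
  replace (/ norm x * (opnorm T * norm x)) with (opnorm T)
    by (field; lra).
  exact B.
- symmetry in x0. destruct (linear_norm T L) as [M [M0 HM]].
  specialize (HM x); rewrite x0 in *; lra.
Qed.

Lemma solves_shift A (z zeta : C) (x y : H) :
  solves A zeta x y <-> solves A z (plus x (scal (zeta - z)%C y)) y.
Proof.
assert (E : minus (A y) (scal z y)
            = plus (minus (A y) (scal zeta y)) (scal (zeta - z)%C y)).
{ etransitivity; [apply (minus_trans (scal zeta y))|].
  f_equal; symmetry; apply (scal_minus_distr_r (K := C_Ring)). }
unfold solves; rewrite E; split; intros [D S]; split; auto.
- rewrite S; reflexivity.
- eapply plus_reg_r; exact S.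
Qed.

Lemma resolvent_solves A (z : C) (x : H) :
  resolvent_set A z -> solves A z x (resolvent A z x).
Proof. intros [U _]; exact (iota_correct (solves A z x) (U x)). Qed.

Lemma resolvent_unique A (z : C) (x y : H) :
  resolvent_set A z -> solves A z x y -> resolvent A z x = y.
Proof.
intros R S; destruct (proj1 R x) as [y0 [_ U]].
rewrite <- (U _ S); symmetry; apply U, resolvent_solves, R.
Qed.

(** The first resolvent identity. Its instance with [z] and [zeta] exchanged has
    the two resolvents composed in the other order; the two instances together
    do the work of the commutation of resolvents. *)
Lemma resolvent_identity A (z zeta : C) (x : H) :
  resolvent_set A z -> resolvent_set A zeta ->
  resolvent A zeta x =
  plus (resolvent A z x)
       (scal (zeta - z)%C (resolvent A z (resolvent A zeta x))).
Proof.
intros R S; assert (L := proj2 R).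
assert (E := proj1 (solves_shift A z zeta x _) (resolvent_solves A zeta x S)).
apply (resolvent_unique _ _ _ _ R) in E.
rewrite <- E at 1.
rewrite (linear_op_plus _ L), (linear_op_scal _ L); reflexivity.
Qed.

Lemma resolvent_norm_le A (z : C) (x : H) : resolvent_set A z ->
  norm (resolvent A z x) <= opnorm (resolvent A z) * norm x.
Proof. intros [_ L]; apply norm_le_opnorm, L. Qed.

(** The fixed point is the Neumann series of [T] applied to [v]. *)
Lemma affine_fixed_point (T : H -> H) (q : R) (v : H) :
  is_linear T -> 0 <= q < 1 -> (forall x, norm (T x) <= q * norm x) ->
  exists y, y = plus v (T y).
Proof.
intros L q1 Hq.
set (u := fun n => Nat.iter n T v).
assert (B : forall n, norm (u n) <= norm v * q ^ n).
{ induction n as [|n IH]; simpl; [lra|].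
  apply Rle_trans with (1 := Hq _).
  replace (norm v * (q * q ^ n)) with (q * (norm v * q ^ n)) by ring.
  apply Rmult_le_compat_l; [lra | exact IH]. }
assert (Eu : ex_series u).
{ apply ex_series_le with (1 := B).
  apply (ex_series_scal (V := R_NormedModule) (norm v) (fun n => q ^ n)).
  apply ex_series_geom.
  rewrite Rabs_pos_eq; lra. }
destruct Eu as [y Hy]; exists y.
assert (Rec0 : forall n, sum_n u (S n) = plus (sum_n u n) (u (S n)))
  by (intros n; exact (sum_Sn u n)).
assert (Rec : forall n, sum_n u (S n) = plus v (T (sum_n u n))).
{ induction n as [|n IH].
  - rewrite Rec0, sum_O; reflexivity.
  - rewrite (Rec0 (S n)), IH at 1; rewrite (Rec0 n), (linear_op_plus T L).
    symmetry; apply plus_A. }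
apply (filterlim_locally_unique (F := eventually) (fun n => sum_n u (S n))).
- apply filterlim_comp with (2 := Hy).
  apply eventually_subseq; intros; lia.
- apply filterlim_ext with (fun n => plus v (T (sum_n u n))).
  { intros n; symmetry; apply Rec. }
  apply (filterlim_comp_2 (G := locally v) (H := locally (T y)))
    with (3 := filterlim_plus v (T y)).
  + apply filterlim_const.
  + apply filterlim_comp with (1 := Hy); exact (linear_cont T y L).
Qed.

(** [A - zeta] is inverted by solving [y = R x + (zeta - z) R y], a contraction
    in [y] because of the bound on [Cmod (zeta - z)]. *)
Lemma resolvent_set_ball A (z zeta : C) :
  resolvent_set A z ->
  Cmod (zeta - z) * opnorm (resolvent A z) <= / 2 ->
  resolvent_set A zeta.
Proof.
intros R Hw; assert (L := proj2 R).
set (Rz := resolvent A z) in *; set (w := (zeta - z)%C) in *.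
set (T := fun y : H => scal w (Rz y)).
assert (HT : forall y, norm (T y) <= / 2 * norm y).
{ intros y; unfold T; rewrite norm_scal_C.
  apply Rle_trans with (Cmod w * opnorm Rz * norm y).
  - rewrite Rmult_assoc. apply Rmult_le_compat_l; [apply Cmod_ge_0|].
    apply norm_le_opnorm, L.
  - apply Rmult_le_compat_r; [apply norm_ge_0 | exact Hw]. }
assert (LT : is_linear T)
  by exact (is_linear_comp Rz (fun y => scal w y) L
              (is_linear_scal_r w Cmult_comm)).
assert (Fix : forall x y, solves A zeta x y <-> y = plus (Rz x) (T y)).
{ intros x y; rewrite (solves_shift A z zeta).
  assert (E : Rz (plus x (scal w y)) = plus (Rz x) (T y)).
  { rewrite (linear_op_plus _ L), (linear_op_scal _ L); reflexivity. }
  split; intros S.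
  - rewrite <- E; symmetry; exact (resolvent_unique _ _ _ _ R S).
  - fold w. rewrite S at 2. rewrite <- E. exact (resolvent_solves A z _ R). }
assert (U : forall x y y', solves A zeta x y -> solves A zeta x y' -> y = y').
{ intros x y y' S S'; apply Fix in S; apply Fix in S'.
  assert (D : minus y y' = T (minus y y')).
  { transitivity (minus (plus (Rz x) (T y)) (plus (Rz x) (T y'))).
    - rewrite <- S, <- S'; reflexivity.
    - etransitivity; [exact (minus_plus_plus (Rz x) (T y) (T y'))|].
      symmetry; exact (linear_minus T y y' LT). }
  assert (B := HT (minus y y')); rewrite <- D in B.
  assert (P := norm_ge_0 (minus y y')).
  assert (Z : minus y y' = zero) by (refine (norm_eq_zero (minus y y') _); lra).
  refine (plus_reg_r (opp y') y y' _).
  etransitivity; [exact Z | symmetry; exact (plus_opp_r y')]. }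
assert (E : forall x, exists! y, solves A zeta x y).
{ intros x.
  destruct (affine_fixed_point T (/ 2) (Rz x) LT ltac:(lra) HT) as [y Hy].
  exists y; split; [apply Fix, Hy |].
  intros y'; apply (U x), Fix, Hy. }
split; [exact E|].
assert (S : forall x, solves A zeta x (resolvent A zeta x)).
{ intros x; exact (iota_correct (solves A zeta x) (E x)). }
split.
- intros x y; apply (U (plus x y)); [apply S|].
  apply Fix; rewrite (linear_op_plus _ L), (linear_op_plus _ LT).
  rewrite (proj1 (Fix _ _) (S x)) at 1.
  rewrite (proj1 (Fix _ _) (S y)) at 1.
  apply plus_medial.
- intros k x; apply (U (scal k x)); [apply S|].
  apply Fix; rewrite (linear_op_scal _ L), (linear_op_scal _ LT).
  rewrite (proj1 (Fix _ _) (S x)) at 1.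
  apply scal_plus.
- exists (2 * opnorm Rz + 1).
  assert (P := opnorm_ge_0 _ L); fold Rz in P.
  split; [lra|]. intros x.
  assert (N := norm_plus_le (Rz x) (T (resolvent A zeta x))).
  rewrite <- (proj1 (Fix _ _) (S x)) in N.
  assert (B := HT (resolvent A zeta x)).
  assert (B' := norm_le_opnorm Rz x L).
  assert (x0 := norm_ge_0 x). lra.
Qed.

(** * Second-order perturbation of the resolvent norm *)

(** The resolvent identity, used three times, writes [R(zeta) x] in the form of
    [norm_expansion_ge] with [c = R^3 x] and [e = R^3 R(zeta) x]. The
    remainder is uniform in [x] and [zeta] because
    [norm (R(zeta) x) <= 2 * opnorm R]. *)
Lemma resolvent_norm_sq_ge A (z zeta : C) (x : H) :
  resolvent_set A z -> resolvent_set A zeta -> norm x = 1 ->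
  Cmod (zeta - z) * opnorm (resolvent A z) <= / 2 ->
  let R := resolvent A z in
  let w := (zeta - z)%C in
  norm (R x) ^ 2 + 2 * Re (w * inner (R x) (R (R x)))
    + Cmod w ^ 2 * norm (R (R x)) ^ 2
    + 2 * Re (w * w * inner (R x) (R (R (R x))))
    - 8 * opnorm R ^ 5 * Cmod w ^ 3
  <= norm (resolvent A zeta x) ^ 2.
Proof.
intros Rz Rzeta x1 Hw R w.
assert (L := proj2 Rz); fold R in L.
set (y := resolvent A zeta x).
assert (I : y = plus (R x) (scal w (R y)))
  by exact (resolvent_identity A z zeta x Rz Rzeta).
assert (I1 : R y = plus (R (R x)) (scal w (R (R y)))).
{ rewrite I at 1. rewrite (linear_op_plus _ L), (linear_op_scal _ L); reflexivity. }
assert (I2 : R (R y) = plus (R (R (R x))) (scal w (R (R (R y))))).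
{ rewrite I1 at 1. rewrite (linear_op_plus _ L), (linear_op_scal _ L); reflexivity. }
assert (E : y = plus (plus (R x) (scal w (R (R x))))
   (scal (w * w)%C (plus (R (R (R x))) (scal w (R (R (R y))))))).
{ rewrite <- I2, <- plus_A. rewrite I at 1. rewrite I1 at 1. f_equal.
  rewrite scal_plus, scal_scal; reflexivity. }
assert (G := norm_expansion_ge (R x) (R (R x)) (R (R (R x))) (R (R (R y))) w).
rewrite <- E, <- I2 in G.
set (r := opnorm R) in *.
assert (r0 : 0 <= r) by apply (opnorm_ge_0 _ L).
assert (N : forall v, norm (R v) <= r * norm v)
  by (intros v; apply norm_le_opnorm, L).
assert (Ny : norm y <= 2 * r).
{ assert (T := norm_plus_le (R x) (scal w (R y))).
  rewrite <- I, norm_scal_C in T.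
  assert (T1 := N x); rewrite x1 in T1.
  assert (T2 : Cmod w * norm (R y) <= Cmod w * (r * norm y))
    by (apply Rmult_le_compat_l; [apply Cmod_ge_0 | apply N]).
  assert (T3 : Cmod w * r * norm y <= / 2 * norm y)
    by (apply Rmult_le_compat_r; [apply norm_ge_0 | exact Hw]).
  lra. }
assert (N' : forall v m, norm v <= m -> norm (R v) <= r * m).
{ intros v m Hv; apply Rle_trans with (1 := N v).
  apply Rmult_le_compat_l; assumption. }
assert (M1 : norm (R x) * norm (R (R (R y))) <= (r * 1) * (r * (r * (r * (2 * r))))).
{ apply Rmult_le_compat; auto using norm_ge_0. apply N'; lra. }
assert (M2 : norm (R (R x)) * norm (R (R y)) <= (r * (r * 1)) * (r * (r * (2 * r)))).
{ apply Rmult_le_compat; auto using norm_ge_0. apply N', N'; lra. }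
assert (M : 2 * Cmod w ^ 3
      * (norm (R x) * norm (R (R (R y))) + norm (R (R x)) * norm (R (R y)))
   <= 2 * Cmod w ^ 3 * (4 * r ^ 5)).
{ apply Rmult_le_compat_l.
  - apply Rmult_le_pos; [lra | apply pow_le, Cmod_ge_0].
  - simpl pow; lra. }
lra.
Qed.

End Resolvents.

Lemma is_lim_seq_Re_Cmult (w l : C) (u : nat -> C) :
  filterlim u eventually (locally l) ->
  is_lim_seq (fun n => Re (w * u n)) (Re (w * l)).
Proof.
intros Hu.
assert (H1 : is_lim_seq (fun n => fst (u n)) (fst l)).
{ apply (filterlim_comp _ _ _ u fst _ _ _ Hu), continuous_fst. }
assert (H2 : is_lim_seq (fun n => snd (u n)) (snd l)).
{ apply (filterlim_comp _ _ _ u snd _ _ _ Hu), continuous_snd. }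
apply is_lim_seq_minus'; apply is_lim_seq_mult';
  auto using is_lim_seq_const.
Qed.

(** The bound [d <= 1] makes [c = d / (2 r + 1)] at most [1], whence
    [(r + c)^2 = r^2 + 2 r c + c^2 <= r^2 + (2 r + 1) c = r^2 + d]. *)
Lemma gain_of_sq_gain (r s d : R) :
  0 <= r -> 0 <= s -> 0 <= d <= 1 -> r ^ 2 + d <= s ^ 2 ->
  r + d / (2 * r + 1) <= s.
Proof.
intros r0 s0 d01 Hs.
set (c := d / (2 * r + 1)).
assert (Ec : d = (2 * r + 1) * c) by (unfold c; field; lra).
assert (c0 : 0 <= c) by (apply Rdiv_le_0_compat; lra).
assert (c1 : c <= 1).
{ apply Rmult_le_reg_l with (2 * r + 1); lra. }
assert (c2 : c * c <= c * 1) by (apply Rmult_le_compat_l; assumption).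
apply Rsqr_incr_0_var; [|assumption].
unfold Rsqr; simpl in Hs. lra.
Qed.

Section Growth.

Context {H : HilbertSpace}.
Variables (A : operator H) (z : C) (psi : nat -> H) (alpha : C) (beta : R)
  (gamma : C).

Hypothesis Rz : resolvent_set A z.
Hypothesis psi_unit : forall n, norm (psi n) = 1.
Hypothesis psi_max : is_lim_seq
  (fun n => norm (resolvent A z (psi n))) (opnorm (resolvent A z)).
Hypothesis lim_alpha : filterlim
  (fun n => inner (resolvent A z (psi n))
                  (resolvent A z (resolvent A z (psi n))))
  eventually (locally alpha).
Hypothesis lim_beta : is_lim_seq
  (fun n => norm (resolvent A z (resolvent A z (psi n))) ^ 2) beta.
Hypothesis lim_gamma : filterlim
  (fun n => inner (resolvent A z (psi n))
                  (resolvent A z (resolvent A z (resolvent A z (psi n)))))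
  eventually (locally gamma).

(** The increment of [opnorm (resolvent A zeta) ^ 2] predicted by the three
    limits, up to an error of third order in [w = zeta - z]. *)
Definition increment (w : C) : R :=
  2 * Re (w * alpha) + Cmod w ^ 2 * beta + 2 * Re (w * w * gamma).

Lemma beta_ge_0 : 0 <= beta.
Proof.
apply (is_lim_seq_le (fun _ => 0) (fun n =>
  norm (resolvent A z (resolvent A z (psi n))) ^ 2) 0 beta).
- intros n; apply pow2_ge_0.
- apply is_lim_seq_const.
- exact lim_beta.
Qed.

Lemma opnorm_sq_ge (zeta : C) :
  resolvent_set A zeta ->
  Cmod (zeta - z) * opnorm (resolvent A z) <= / 2 ->
  opnorm (resolvent A z) ^ 2 + increment (zeta - z)
    - 8 * opnorm (resolvent A z) ^ 5 * Cmod (zeta - z) ^ 3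
  <= opnorm (resolvent A zeta) ^ 2.
Proof.
intros Rzeta Hw.
set (w := (zeta - z)%C) in *; set (r := opnorm (resolvent A z)) in *.
refine (is_lim_seq_le _ (fun _ => opnorm (resolvent A zeta) ^ 2)
  (Finite _) (Finite _)
  (fun n => Rle_trans _ _ _ (resolvent_norm_sq_ge A z zeta (psi n) Rz Rzeta
    (psi_unit n) Hw) _) _ (is_lim_seq_const _)).
- apply pow_incr; split; [apply norm_ge_0|].
  rewrite <- (Rmult_1_r (opnorm _)), <- (psi_unit n).
  apply resolvent_norm_le, Rzeta.
- fold w; fold r; unfold increment.
  apply is_lim_seq_minus'; [|apply is_lim_seq_const].
  rewrite <- !Rplus_assoc.
  apply is_lim_seq_plus'; [apply is_lim_seq_plus'; [apply is_lim_seq_plus'|]|].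
  + simpl pow. do 2 (apply is_lim_seq_mult'; [exact psi_max|]).
    apply is_lim_seq_const.
  + apply is_lim_seq_mult'; [apply is_lim_seq_const|].
    apply is_lim_seq_Re_Cmult, lim_alpha.
  + apply is_lim_seq_mult'; [apply is_lim_seq_const | exact lim_beta].
  + apply is_lim_seq_mult'; [apply is_lim_seq_const|].
    apply (is_lim_seq_Re_Cmult (w * w)%C), lim_gamma.
Qed.

(** The common core of the three growth statements: the increment only has to
    have order [k] along the values of [zeta] considered, whatever set they
    form. Since [k <= 2], the cubic remainder is of order at least [k + 1]. *)
Lemma growth (k : nat) (m l : R) :
  (1 <= k <= 2)%nat -> 0 < m -> 0 <= l ->
  exists c eps0 : R, 0 < c /\ 0 < eps0 /\
  forall zeta : C, Cmod (zeta - z) <= eps0 ->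
    resolvent_set A zeta /\
    (2 * m * Cmod (zeta - z) ^ k - l * Cmod (zeta - z) ^ S k
       <= increment (zeta - z) ->
     opnorm (resolvent A zeta) >=
     opnorm (resolvent A z) + c * Cmod (zeta - z) ^ k).
Proof.
intros Hk m0 l0.
set (r := opnorm (resolvent A z)).
assert (r0 : 0 <= r) by apply (opnorm_ge_0 _ (proj2 Rz)).
set (K := 8 * r ^ 5).
assert (K0 : 0 <= K) by (apply Rmult_le_pos; [lra | apply pow_le, r0]).
set (m' := Rmin m 1).
assert (m'0 : 0 < m') by (apply Rmin_pos; lra).
(* The three bounds on [eps0] give, in this order, [rho <= 1],
   [(l + K) rho <= m], so that the terms of order [k + 1] use up half of the
   increment, and [rho r <= 1/2]. *)
exists (m' / (2 * r + 1)), (Rmin (Rmin 1 (m / (l + K + 1))) (/ (2 * (r + 1)))).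
split; [apply Rdiv_lt_0_compat; lra|].
split.
{ repeat apply Rmin_pos; try apply Rdiv_lt_0_compat;
    try apply Rinv_0_lt_compat; lra. }
intros zeta Hz; set (rho := Cmod (zeta - z)) in *.
assert (rho0 : 0 <= rho) by apply Cmod_ge_0.
assert (e1 : rho <= 1)
  by (eapply Rle_trans; [exact Hz | eapply Rle_trans; apply Rmin_l]).
assert (e2 : rho * (l + K) <= m).
{ apply Rle_trans with (rho * (l + K + 1)); [apply Rmult_le_compat_l; lra|].
  apply Rle_trans with (m / (l + K + 1) * (l + K + 1)).
  - apply Rmult_le_compat_r; [lra|].
    eapply Rle_trans; [exact Hz | eapply Rle_trans; [apply Rmin_l|apply Rmin_r]].
  - right; field; lra. }
assert (e3 : rho * r <= / 2).
{ apply Rle_trans with (rho * (r + 1)); [apply Rmult_le_compat_l; lra|].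
  apply Rle_trans with (/ (2 * (r + 1)) * (r + 1)).
  - apply Rmult_le_compat_r; [lra|].
    eapply Rle_trans; [exact Hz | apply Rmin_r].
  - right; field; lra. }
assert (Rzeta : resolvent_set A zeta) by (apply resolvent_set_ball with z; auto).
split; [exact Rzeta|].
intros Hinc; apply Rle_ge.
assert (G := opnorm_sq_ge zeta Rzeta e3); fold rho r K in G.
assert (p0 : 0 <= rho ^ k) by (apply pow_le, rho0).
assert (p1 : rho ^ k <= 1).
{ rewrite <- (pow1 k); apply pow_incr; lra. }
assert (p3 : rho ^ 3 <= rho ^ S k).
{ destruct Hk as [k1 k2]; destruct k as [|[|[|k]]]; try lia; simpl; try lra.
  assert (rho * rho * rho <= rho * rho * 1)
    by (apply Rmult_le_compat_l; [apply Rmult_le_pos|]; lra).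
  lra. }
assert (p4 : K * rho ^ 3 <= K * rho ^ S k) by (apply Rmult_le_compat_l; lra).
assert (p5 : rho * (l + K) * rho ^ k <= m * rho ^ k)
  by (apply Rmult_le_compat_r; lra).
assert (p6 : m' * rho ^ k <= m * rho ^ k).
{ apply Rmult_le_compat_r; [lra | apply Rmin_l]. }
assert (p7 : m' * rho ^ k <= 1 * 1).
{ apply Rmult_le_compat; try lra; apply Rmin_r. }
assert (p8 : 0 <= m' * rho ^ k) by (apply Rmult_le_pos; lra).
replace (m' / (2 * r + 1) * rho ^ k) with (m' * rho ^ k / (2 * r + 1))
  by (field; lra).
apply gain_of_sq_gain; try lra.
- apply (opnorm_ge_0 _ (proj2 Rzeta)).
- simpl pow in *; lra.
Qed.

(** When [beta = 0] the vectors [R (psi n)] are approximately annihilated by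
    [R], hence by [R(zeta)], which by the resolvent identity maps [psi n]
    approximately to [R (psi n)] for every [zeta], however far from [z]. *)
Lemma opnorm_ge_of_beta_0 (zeta : C) :
  beta = 0 -> resolvent_set A zeta ->
  opnorm (resolvent A zeta) >= opnorm (resolvent A z).
Proof.
intros b0 Rzeta; apply Rle_ge.
set (R := resolvent A z); set (S := resolvent A zeta); set (w := (z - zeta)%C).
assert (s0 := opnorm_ge_0 _ (proj2 Rzeta)); fold S in s0.
assert (w0 := Cmod_ge_0 w).
set (M := Cmod w * (1 + Cmod w * opnorm S)).
assert (lim0 : is_lim_seq (fun n => norm (R (R (psi n)))) 0).
{ apply is_lim_seq_ext with (fun n => sqrt (norm (R (R (psi n))) ^ 2)).
  { intros n; apply sqrt_pow2, norm_ge_0. }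
  rewrite <- sqrt_0 at 1.
  apply is_lim_seq_continuous; [apply continuity_pt_sqrt; lra|].
  rewrite <- b0; exact lim_beta. }
assert (I : forall x, R x = plus (S x) (scal w (S (R x)))).
{ intros x; exact (resolvent_identity A zeta z x Rzeta Rz). }
assert (NS : forall x, norm (S x) <= opnorm S * norm x)
  by (intros x; apply resolvent_norm_le, Rzeta).
assert (N1 : forall x, norm (S x) <= norm (R x) + Cmod w * (opnorm S * norm (R x))).
{ intros x.
  assert (T : Rabs (norm (S x) - norm (R x)) <= norm (minus (S x) (R x)))
  by exact (norm_triangle_inv (S x) (R x)).
  assert (E : norm (minus (S x) (R x)) = Cmod w * norm (S (R x))).
  { rewrite (I x) at 1. rewrite norm_minus_plus, norm_scal_C. reflexivity. }
  rewrite E in T.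
  assert (T' := Rle_abs (norm (S x) - norm (R x))).
  assert (Cmod w * norm (S (R x)) <= Cmod w * (opnorm S * norm (R x)))
    by (apply Rmult_le_compat_l; auto).
  lra. }
assert (N2 : forall n, norm (R (psi n)) <= opnorm S + M * norm (R (R (psi n)))).
{ intros n.
  assert (T := norm_plus_le (S (psi n)) (scal w (S (R (psi n))))).
  rewrite <- I, norm_scal_C in T.
  assert (T1 := NS (psi n)); rewrite psi_unit in T1.
  assert (T2 := Rmult_le_compat_l _ _ _ w0 (N1 (R (psi n)))).
  unfold M; lra. }
assert (Lim : is_lim_seq (fun n => opnorm S + M * norm (R (R (psi n))))
                (opnorm S + M * 0)).
{ apply is_lim_seq_plus'; [apply is_lim_seq_const|].
  apply is_lim_seq_mult'; [apply is_lim_seq_const | exact lim0]. }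
assert (G := is_lim_seq_le _ _ _ _ N2 psi_max Lim).
simpl in G; fold R in G; lra.
Qed.

End Growth.

(** * Arguments along a segment *)

Definition polar (rho t : R) : C := (RtoC rho * (cos t, sin t))%C.

Lemma polar_mult (rho s t u : R) :
  (polar rho t * polar s u)%C = polar (rho * s) (t + u).
Proof.
unfold polar; rewrite cos_plus, sin_plus.
apply injective_projections; simpl; ring.
Qed.

Lemma Re_polar (rho t : R) : Re (polar rho t) = rho * cos t.
Proof. unfold polar, Re; simpl; ring. Qed.

Lemma segment_polar (z z' zeta : C) (t : R) :
  is_arg (z' - z) t -> segment z z' zeta ->
  (zeta - z)%C = polar (Cmod (zeta - z)) t /\
  Cmod (zeta - z) <= Cmod (z' - z).
Proof.
intros [_ E] [s [s01 ->]].
replace (z + RtoC s * (z' - z) - z)%C with (RtoC s * (z' - z))%C by ring.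
rewrite Cmod_mult, Cmod_R, Rabs_pos_eq by lra; split.
- rewrite E at 1; unfold polar; rewrite RtoC_mult; ring.
- rewrite <- (Rmult_1_l (Cmod (z' - z))) at 2.
  apply Rmult_le_compat_r; [apply Cmod_ge_0 | lra].
Qed.

Lemma is_arg_polar (w : C) (t : R) : is_arg w t -> w = polar (Cmod w) t.
Proof. intros [_ E]; exact E. Qed.

Lemma Re_ge_Cmod (w : C) : - Cmod w <= Re w.
Proof.
assert (B := re_le_Cmod w); apply Rabs_le_between in B; lra.
Qed.

Theorem theorem1p2 :
  forall (H : HilbertSpace) (A : operator H) (z : C) (psi : nat -> H)
         (alpha : C) (beta : R) (gamma : C),
  separable H ->
  closed_operator A ->
  densely_defined A ->
  (exists w : C, resolvent_set A w) ->
  resolvent_set A z ->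
  (forall n, norm (psi n) = 1) ->
  is_lim_seq (fun n => norm (resolvent A z (psi n))) (opnorm (resolvent A z)) ->
  filterlim
    (fun n => inner (resolvent A z (psi n))
                    (resolvent A z (resolvent A z (psi n))))
    eventually (locally alpha) ->
  is_lim_seq (fun n => norm (resolvent A z (resolvent A z (psi n))) ^ 2) beta ->
  filterlim
    (fun n => inner (resolvent A z (psi n))
                    (resolvent A z (resolvent A z (resolvent A z (psi n)))))
    eventually (locally gamma) ->
  (alpha <> RtoC 0 ->
   forall arg_alpha : R, is_arg alpha arg_alpha ->
   forall theta : R, - (PI / 2) < theta < PI / 2 ->
   exists c eps0 : R, 0 < c /\ 0 < eps0 /\
   forall z' : C, z' <> z -> Cmod (z' - z) <= eps0 ->
   is_arg (z' - z) (theta - arg_alpha) ->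
   (forall zeta : C, segment z z' zeta -> resolvent_set A zeta) /\
   (forall zeta : C, segment z z' zeta ->
      opnorm (resolvent A zeta) >=
      opnorm (resolvent A z) + c * Cmod (zeta - z)))
  /\
  (alpha = RtoC 0 -> gamma <> RtoC 0 ->
   forall arg_gamma : R, is_arg gamma arg_gamma ->
   forall theta : R,
   (- (PI / 4) < theta < PI / 4 \/ 3 * PI / 4 < theta < 5 * PI / 4) ->
   exists c eps0 : R, 0 < c /\ 0 < eps0 /\
   forall z' : C, z' <> z -> Cmod (z' - z) <= eps0 ->
   is_arg (z' - z) (theta - arg_gamma / 2) ->
   (forall zeta : C, segment z z' zeta -> resolvent_set A zeta) /\
   (forall zeta : C, segment z z' zeta ->
      opnorm (resolvent A zeta) >=
      opnorm (resolvent A z) + c * Cmod (zeta - z) ^ 2))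
  /\
  (alpha = RtoC 0 -> gamma = RtoC 0 -> 0 < beta ->
   exists c eps0 : R, 0 < c /\ 0 < eps0 /\
   forall zeta : C, resolvent_set A zeta -> Cmod (zeta - z) <= eps0 ->
      opnorm (resolvent A zeta) >=
      opnorm (resolvent A z) + c * Cmod (zeta - z) ^ 2)
  /\
  (beta = 0 ->
   forall zeta : C, resolvent_set A zeta ->
      opnorm (resolvent A zeta) >= opnorm (resolvent A z)).
Proof.
intros H A z psi alpha beta gamma _ _ _ _ Rz psi1 psi_max lim_a lim_b lim_c.
assert (G := growth A z psi alpha beta gamma Rz psi1 psi_max lim_a lim_b lim_c).
assert (b0 := beta_ge_0 A z psi beta lim_b).
split; [|split; [|split]].
- intros alpha0 arg_a Ha theta Htheta.
  assert (m0 : 0 < Cmod alpha * cos theta).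
  { apply Rmult_lt_0_compat; [apply Cmod_gt_0, alpha0 | apply cos_gt_0; lra]. }
  destruct (G 1%nat _ (2 * Cmod gamma) ltac:(lia) m0
    ltac:(generalize (Cmod_ge_0 gamma); lra)) as [c [eps0 [c0 [e0 Hg]]]].
  exists c, eps0; split; [exact c0 | split; [exact e0 |]].
  intros z' _ Hz' Harg.
  split; intros zeta Hzeta;
    destruct (segment_polar _ _ _ _ Harg Hzeta) as [Ew Hw];
    destruct (Hg zeta ltac:(lra)) as [Rzeta Hgrow]; [exact Rzeta|].
  rewrite pow_1 in Hgrow; apply Hgrow.
  set (w := (zeta - z)%C) in *; unfold increment.
  assert (E1 : Re (w * alpha) = Cmod w * Cmod alpha * cos theta).
  { transitivity (Re (polar (Cmod w) (theta - arg_a) * polar (Cmod alpha) arg_a)).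
    { rewrite <- Ew, <- (is_arg_polar _ _ Ha); reflexivity. }
    rewrite polar_mult, Re_polar. do 2 f_equal; lra. }
  assert (E2 := Re_ge_Cmod (w * w * gamma)%C); rewrite !Cmod_mult in E2.
  assert (E3 : 0 <= Cmod w ^ 2 * beta)
    by (apply Rmult_le_pos; [apply pow2_ge_0 | exact b0]).
  rewrite E1; simpl pow in *; lra.
- intros alpha0 gamma0 arg_g Hg' theta Htheta.
  assert (cos0 : 0 < cos (2 * theta)).
  { destruct Htheta as [Ht | Ht]; [apply cos_gt_0; lra|].
    (* A full turn brings the second range of [2 theta] back to the first. *)
    replace (2 * theta) with (2 * theta - 2 * PI + 2 * INR 1 * PI)
      by (simpl; ring).
    rewrite cos_period; apply cos_gt_0; lra. }
  assert (m0 : 0 < Cmod gamma * cos (2 * theta)).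
  { apply Rmult_lt_0_compat; [apply Cmod_gt_0, gamma0 | exact cos0]. }
  destruct (G 2%nat _ 0 ltac:(lia) m0 (Rle_refl 0))
    as [c [eps0 [c0 [e0 Hg]]]].
  exists c, eps0; split; [exact c0 | split; [exact e0 |]].
  intros z' _ Hz' Harg.
  split; intros zeta Hzeta;
    destruct (segment_polar _ _ _ _ Harg Hzeta) as [Ew Hw];
    destruct (Hg zeta ltac:(lra)) as [Rzeta Hgrow]; [exact Rzeta|].
  apply Hgrow.
  set (w := (zeta - z)%C) in *; unfold increment.
  rewrite alpha0, Cmult_0_r.
  assert (E1 : Re (w * w * gamma) = Cmod w * Cmod w * Cmod gamma * cos (2 * theta)).
  { set (p := polar (Cmod w) (theta - arg_g / 2)) in *.
    transitivity (Re (p * p * polar (Cmod gamma) arg_g)).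
    { rewrite <- Ew, <- (is_arg_polar _ _ Hg'); reflexivity. }
    unfold p; rewrite !polar_mult, Re_polar. do 2 f_equal; lra. }
  assert (E3 : 0 <= Cmod w ^ 2 * beta)
    by (apply Rmult_le_pos; [apply pow2_ge_0 | exact b0]).
  rewrite E1; simpl in *; lra.
- intros alpha0 gamma0 beta0.
  destruct (G 2%nat (beta / 2) 0 ltac:(lia) ltac:(lra) (Rle_refl 0))
    as [c [eps0 [c0 [e0 Hg]]]].
  exists c, eps0; split; [exact c0 | split; [exact e0 |]].
  intros zeta _ Hz; apply (Hg zeta Hz).
  unfold increment; rewrite alpha0, gamma0, !Cmult_0_r; simpl; lra.
- intros beta0 zeta Rzeta.
  exact (opnorm_ge_of_beta_0 A z psi beta Rz psi1 psi_max lim_b zeta beta0 Rzeta).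
Qed.
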